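(* Let $(T,[\cdot,\cdot,\cdot])$ be a Lie triple system and let $N:T\to T$ be a linear operator. Then: (a) If $N^2=0$, then $N$ is a Nijenhuis operator if and only if $N$ is a Rota-Baxter operator of weight $0$. (b) If $N^2=N$, then $N$ is a Nijenhuis operator if and only if $N$ is a Rota-Baxter operator of weight $-1$. (c) If $N^2=\pm\mathrm{id}$, then $N$ is a Nijenhuis operator if and only if $N$ is a modified Rota-Baxter operator of weight $\mp 1$ (that is, weight $-1$ if $N^2=\mathrm{id}$, and weight $1$ if $N^2=-\mathrm{id}$).
   Context: All vector spaces and (multi)linear maps are over an algebraically closed field $\mathbb{K}$ of characteristic $0$. A Lie triple system is a vector space $T$ with a trilinear map $[\cdot,\cdot,\cdot]$ such that $[x,x,y]=0$, $[x,y,z]+[y,z,x]+[z,x,y]=0$ and $[x_1,x_2,[x_3,x_4,x_5]]=[[x_1,x_2,x_3],x_4,x_5]+[x_3,[x_1,x_2,x_4],x_5]+[x_3,x_4,[x_1,x_2,x_5]]$ for all elements of $T$. A linear map $N:T\to T$ is a Nijenhuis operator if for all $x,y,z\in T$ $$[Nx,Ny,Nz]=N\big([Nx,Ny,z]+[x,Ny,Nz]+[Nx,y,Nz]-N([Nx,y,z]+[x,Ny,z]+[x,y,Nz]-N[x,y,z])\big).$$ A linear map $R:T\to T$ is a Rota-Baxter operator of weight $\lambda\in\mathbb{K}$ if for all $x,y,z\in T$ $$[Rx,Ry,Rz]=R\big([Rx,Ry,z]+[x,Ry,Rz]+[Rx,y,Rz]+\lambda[Rx,y,z]+\lambda[x,Ry,z]+\lambda[x,y,Rz]+\lambda^2[x,y,z]\big).$$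 A linear map $R:T\to T$ is a modified Rota-Baxter operator of weight $\lambda\in\mathbb{K}$ if for all $x,y,z\in T$ $$[Rx,Ry,Rz]=R\big([Rx,Ry,z]+[x,Ry,Rz]+[Rx,y,Rz]-\lambda[x,y,z]\big)+\lambda[Rx,y,z]+\lambda[x,Ry,z]+\lambda[x,y,Rz].$$ *)

(* Defs.v *)
From HB Require Import structures.
From mathcomp Require Import all_boot all_order all_algebra.

Set Implicit Arguments.
Unset Strict Implicit.
Unset Printing Implicit Defensive.

Import GRing.Theory.
Local Open Scope ring_scope.

Definition trilinear (K : fieldType) (T : lmodType K) (br : T -> T -> T -> T) :
    Prop :=
  [/\ forall y z, linear (fun x => br x y z),
      forall x z, linear (fun y => br x y z)
    & forall x y, linear (fun z => br x y z)].

Record is_lie_triple_system (K : fieldType) (T : lmodType K)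
    (br : T -> T -> T -> T) : Prop := IsLieTripleSystem {
  lts_trilinear : trilinear br;
  lts_alternating : forall x y, br x x y = 0;
  lts_cyclic : forall x y z, br x y z + br y z x + br z x y = 0;
  lts_derivation : forall x1 x2 x3 x4 x5,
    br x1 x2 (br x3 x4 x5) =
      br (br x1 x2 x3) x4 x5 + br x3 (br x1 x2 x4) x5
      + br x3 x4 (br x1 x2 x5)
}.

Definition nijenhuis_operator (K : fieldType) (T : lmodType K)
    (br : T -> T -> T -> T) (N : {linear T -> T}) : Prop :=
  forall x y z,
    br (N x) (N y) (N z) =
      N (br (N x) (N y) z + br x (N y) (N z) + br (N x) y (N z)
         - N (br (N x) y z + br x (N y) z + br x y (N z) - N (br x y z))).

Definition rota_baxter_operator (K : fieldType) (T : lmodType K)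
    (br : T -> T -> T -> T) (lambda : K) (R : {linear T -> T}) : Prop :=
  forall x y z,
    br (R x) (R y) (R z) =
      R (br (R x) (R y) z + br x (R y) (R z) + br (R x) y (R z)
         + lambda *: br (R x) y z + lambda *: br x (R y) z
         + lambda *: br x y (R z) + lambda ^+ 2 *: br x y z).

Definition modified_rota_baxter_operator (K : fieldType) (T : lmodType K)
    (br : T -> T -> T -> T) (lambda : K) (R : {linear T -> T}) : Prop :=
  forall x y z,
    br (R x) (R y) (R z) =
      R (br (R x) (R y) z + br x (R y) (R z) + br (R x) y (R z)
         - lambda *: br x y z)
      + lambda *: br (R x) y z + lambda *: br x (R y) z
      + lambda *: br x y (R z).

(* Main.v *)
Require Import Defs.
From Corelib Require Import Setoid.
From HB Require Import structures.
From mathcomp Require Import all_boot all_order all_algebra.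

Import GRing.Theory.
Local Open Scope ring_scope.

(** Group the brackets with arguments in [{x, y, z, N x, N y, N z}] by the
    number of arguments on which [N] has acted: let [C] be [br x y z], let [B]
    be the sum of the three brackets with one [N], and [A] the sum of the three
    brackets with two.  By linearity of [N], each notion of operator says that
    [br (N x) (N y) (N z)] equals a fixed expression in [A], [B] and [C]:
    - Nijenhuis:                           [N A - N^2 B + N^3 C];
    - Rota-Baxter of weight [l]:           [N A + l N B + l^2 N C];
    - modified Rota-Baxter of weight [l]:  [N A + l B - l N C].
    A quadratic relation on [N] reduces [N^2 B] and [N^3 C] and makes the
    first expression coincide, for every [x], [y], [z], with the second one
    (relations [N^2 = 0] and [N^2 = N]) or with the third one
    ([N^2 = id] and [N^2 = - id]). *)

Section ExpandedIdentities.

Variables (K : fieldType) (T : lmodType K) (br : T -> T -> T -> T).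
Variable N : {linear T -> T}.

Definition bracket_sum1 x y z : T :=
  br (N x) y z + br x (N y) z + br x y (N z).

Definition bracket_sum2 x y z : T :=
  br (N x) (N y) z + br x (N y) (N z) + br (N x) y (N z).

Lemma nijenhuis_operatorE :
  nijenhuis_operator br N <->
  forall x y z, br (N x) (N y) (N z) =
    N (bracket_sum2 x y z) - N (N (bracket_sum1 x y z))
    + N (N (N (br x y z))).
Proof.
have E x y z :
    N (bracket_sum2 x y z - N (bracket_sum1 x y z - N (br x y z))) =
    N (bracket_sum2 x y z) - N (N (bracket_sum1 x y z))
    + N (N (N (br x y z))).
  by rewrite !raddfB /= opprK addrA.
by split=> h x y z; rewrite h -E.
Qed.

Lemma rota_baxter_operatorE l :
  rota_baxter_operator br l N <->
  forall x y z, br (N x) (N y) (N z) =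
    N (bracket_sum2 x y z) + l *: N (bracket_sum1 x y z)
    + l ^+ 2 *: N (br x y z).
Proof.
have E x y z :
    N (bracket_sum2 x y z + l *: br (N x) y z + l *: br x (N y) z
       + l *: br x y (N z) + l ^+ 2 *: br x y z) =
    N (bracket_sum2 x y z) + l *: N (bracket_sum1 x y z)
    + l ^+ 2 *: N (br x y z).
  by rewrite -!linearZ -!linearD /bracket_sum1 !scalerDr !addrA.
by split=> h x y z; rewrite h -E.
Qed.

Lemma modified_rota_baxter_operatorE l :
  modified_rota_baxter_operator br l N <->
  forall x y z, br (N x) (N y) (N z) =
    N (bracket_sum2 x y z) + l *: bracket_sum1 x y z - l *: N (br x y z).
Proof.
have E x y z :
    N (bracket_sum2 x y z - l *: br x y z)
    + l *: br (N x) y z + l *: br x (N y) z + l *: br x y (N z) =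
    N (bracket_sum2 x y z) + l *: bracket_sum1 x y z - l *: N (br x y z).
  by rewrite [RHS]addrAC linearB linearZ /bracket_sum1 !scalerDr !addrA.
by split=> h x y z; rewrite h -E.
Qed.

End ExpandedIdentities.

Theorem proposition3p8 (K : closedFieldType) (charK : [pchar K] =i pred0)
    (T : lmodType K) (br : T -> T -> T -> T)
    (lts : is_lie_triple_system br) (N : {linear T -> T}) :
  ((forall x, N (N x) = 0) ->
     (nijenhuis_operator br N <-> rota_baxter_operator br 0 N)) /\
  ((forall x, N (N x) = N x) ->
     (nijenhuis_operator br N <-> rota_baxter_operator br (-1) N)) /\
  ((forall x, N (N x) = x) ->
     (nijenhuis_operator br N <-> modified_rota_baxter_operator br (-1) N)) /\
  ((forall x, N (N x) = - x) ->
     (nijenhuis_operator br N <-> modified_rota_baxter_operator br 1 N)).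
Proof.
rewrite nijenhuis_operatorE !rota_baxter_operatorE.
rewrite !modified_rota_baxter_operatorE.
split; [|split; [|split]] => N2.
- by split=> h x y z; rewrite h !N2 expr0n /= !scale0r subr0 !addr0.
- by split=> h x y z; rewrite h !N2 sqrrN expr1n scaleN1r scale1r.
- by split=> h x y z; rewrite h !N2 !scaleN1r opprK.
- by split=> h x y z; rewrite h !N2 !scale1r opprK.
Qed.
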